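(* Fix positive integers $m$ and $t$. Then the sequences $(T(m,n,t))_{n\ge0}$ and $(T(m,n,1)^t)_{n\ge0}$ each satisfy a linear homogeneous recurrence relation with constant coefficients.
   Context: The grid graph $\mathcal{G}(m,n)$ has vertex set $\{(i,j)\in\mathbf{Z}^2: 0\le i<n,\ 0\le j<m\}$, with $(i,j),(i',j')$ adjacent iff $|i-i'|+|j-j'|=1$. A magic labelling of sum $t$ of a graph $G$ is a function $E(G)\to\mathbf{Z}_{\ge0}$ such that for each vertex the labels of the incident edges sum to $t$. $T(m,n,t)$ denotes the number of magic labellings of sum $t$ of $\mathcal{G}(m,n)$; in particular $T(m,n,1)$ is the number of perfect matchings of $\mathcal{G}(m,n)$, i.e. the number of domino tilings of an $m\times n$ board, and $T(m,n,1)^t$ counts domino stackings of height $t$ (ordered $t$-tuples of tilings). *)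

(* Defs.v *)
From HB Require Import structures.
From mathcomp Require Import all_boot all_order all_algebra.

Set Implicit Arguments.
Unset Strict Implicit.
Unset Printing Implicit Defensive.

Import Order.TTheory GRing.Theory Num.Theory.

Section MagicLabelling.
Variables (V : finType) (adj : rel V).

Definition edges : {set {set V}} :=
  [set E : {set V} | [exists x, exists y, adj x y && (E == [set x; y])]].

Definition edge := {E : {set V} | E \in edges}.

Definition magic_labelling (t : nat) (f : edge -> nat) : bool :=
  [forall v : V, \sum_(E : edge | v \in val E) f E == t].

(* The labels of a magic labelling of sum t never exceed t
   (magic_labelling_le), so labellings with values in 'I_t.+1 are all of them;
   magic_countP states this as a count of the nat-valued labellings. *)
Definition magic_count (t : nat) : nat :=
  #|[set f : {ffun edge -> 'I_t.+1} | magic_labelling t (fun E => f E)]|.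

Lemma magic_labelling_le t (f : edge -> nat) E :
  magic_labelling t f -> f E <= t.
Proof.
move=> /forallP magf.
have /[!inE] /existsP[x /existsP[y /andP[_ /eqP defE]]] := valP E.
have /eqP <- := magf x.
by rewrite (bigD1 E) ?leq_addr //= defE set21.
Qed.

Lemma magic_countP t : exists s : seq {ffun edge -> nat},
  [/\ uniq s, forall f, (f \in s) = magic_labelling t f
    & size s = magic_count t].
Proof.
pose w (f : {ffun edge -> 'I_t.+1}) : {ffun edge -> nat} :=
  [ffun E => nat_of_ord (f E)].
have w_inj : injective w.
  by move=> f g /ffunP efg; apply/ffunP=> E; apply/val_inj; have := efg E; rewrite !ffunE.
have magw f : magic_labelling t (w f) = magic_labelling t (fun E => f E).
  by apply: eq_forallb => v; congr (_ == _); apply: eq_bigr => E _; rewrite ffunE.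
exists (map w (enum [set f : {ffun edge -> 'I_t.+1} |
                      magic_labelling t (fun E => f E)])).
split; last by rewrite size_map -cardE.
  by rewrite map_inj_uniq ?enum_uniq.
move=> f; apply/mapP/idP => [[g]|magf].
  by rewrite mem_enum inE => magg ->; rewrite magw.
have def_f : w [ffun E => inord (f E)] = f.
  by apply/ffunP=> E; rewrite !ffunE inordK // ltnS magic_labelling_le.
exists [ffun E => inord (f E)]; last by rewrite def_f.
by rewrite mem_enum inE -magw def_f.
Qed.

End MagicLabelling.

Definition grid_adj (m n : nat) : rel ('I_n * 'I_m) := fun x y =>
  (`|(x.1 : nat)%:Z - (y.1 : nat)%:Z| + `|(x.2 : nat)%:Z - (y.2 : nat)%:Z|
     == 1)%R.

Definition T (m n t : nat) : nat := magic_count (@grid_adj m n) t.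

(* The recurrence has some order k >= 1 (hence c k != 0) and holds from the
   start of the sequence, i.e. for every n >= k. *)
Definition linear_recurrent (a : nat -> nat) : Prop :=
  exists (k : nat) (c : nat -> rat),
    [/\ 0 < k, (c k != 0)%R
      & forall n, k <= n ->
          ((a n)%:R = \sum_(1 <= i < k.+1) c i * (a (n - i)%N)%:R :> rat)%R].

(* Main.v *)
Require Import Defs.
From mathcomp Require Import all_boot all_order all_algebra.
From mathcomp Require Import zify.

(* Transfer matrix.  A magic labelling of the m x n grid is a walk of n steps,
   from 0 to 0, on the states s in {0..t}^m (labels of the horizontal edges
   between consecutive columns); the number A(s, r) of vertical labellings
   compatible with s on the left and r on the right is symmetric in s, r.  Hence
   T(m, n, t) = <e_0, A^n e_0>.  Products of such sequences come from tensor
   products of kernels, so T(m, n, 1)^t has the same form.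
   A polynomial p <> 0 with p(A) e_0 = 0 gives a recurrence.  For it to hold from
   n = 0 with nonzero last coefficient, the factors X of p must be removed: A is
   symmetric, so A is injective on its image, and e_0 = A e_(t,...,t) lies in
   that image. *)

Set Implicit Arguments.
Unset Strict Implicit.
Unset Printing Implicit Defensive.

Import Order.TTheory GRing.Theory Num.Theory.
Local Open Scope ring_scope.

(** * Symmetric kernels on a finite set and the recurrences of their walks *)

Section KernelOperator.
Variables (S : finType) (A : S -> S -> rat).

Definition kernel_op (x : S -> rat) (s : S) : rat := \sum_r A s r * x r.

Definition kernel_walk (s0 : S) (n : nat) : S -> rat :=
  iter n kernel_op (fun s => (s == s0)%:R).

Lemma eq_kernel_op x y : x =1 y -> kernel_op x =1 kernel_op y.
Proof. by move=> xy s; apply: eq_bigr => r _; rewrite xy. Qed.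

Lemma kernel_op_sum (N : nat) (c : nat -> rat) (x : nat -> S -> rat) s :
  kernel_op (fun r => \sum_(i < N) c i * x i r) s =
  \sum_(i < N) c i * kernel_op (x i) s.
Proof.
rewrite /kernel_op; under eq_bigr do rewrite mulr_sumr.
rewrite exchange_big; apply: eq_bigr => i _; rewrite mulr_sumr.
by apply: eq_bigr => r _; rewrite mulrCA.
Qed.

Hypothesis symA : forall s r, A s r = A r s.

(* |Ax|^2 = <x, A^2 x> for symmetric A. *)
Lemma kernel_op_sqr_eq0 x :
  kernel_op (kernel_op x) =1 (fun=> 0) -> kernel_op x =1 (fun=> 0).
Proof.
move=> AAx0 s.
have sum0 : \sum_r kernel_op x r ^+ 2 = 0.
  transitivity (\sum_r x r * kernel_op (kernel_op x) r); last first.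
    by rewrite big1 // => r _; rewrite AAx0 mulr0.
  under eq_bigr do rewrite expr2 {1}/kernel_op mulr_suml.
  rewrite exchange_big; apply: eq_bigr => r _; rewrite [in RHS]/kernel_op mulr_sumr.
  by apply: eq_bigr => r' _; rewrite symA mulrCA mulrA.
have /(_ s isT)/eqP := psumr_eq0P (fun r _ => sqr_ge0 (kernel_op x r)) sum0.
by rewrite sqrf_eq0 => /eqP.
Qed.

Variable s0 : S.

(** With [q] the polynomial of coefficients [c i], [i < N], this is the vector [A^n q(A) e_s0]. *)
Let comb (N : nat) (c : nat -> rat) (n : nat) (s : S) : rat :=
  \sum_(i < N) c i * kernel_walk s0 (n + i) s.

Lemma comb_walkS N c n : comb N c n.+1 =1 kernel_op (comb N c n).
Proof. by move=> s; exact/esym/(kernel_op_sum N c (fun i => kernel_walk s0 (n + i))). Qed.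

Lemma comb_walk_up N c n : comb N c 0 =1 (fun=> 0) -> comb N c n =1 (fun=> 0).
Proof.
move=> c0; elim: n => // n IHn s; rewrite comb_walkS (eq_kernel_op IHn).
by rewrite /kernel_op big1 // => r _; rewrite mulr0.
Qed.

Variable g : S.
Hypothesis walk_g : forall s, A s g = (s == s0)%:R.

(** One factor [A] is cancelled at a time: each [comb] lies in the image of [A], on which [A] is
    injective by [kernel_op_sqr_eq0]. *)
Lemma comb_walk_down N c n : comb N c n =1 (fun=> 0) -> comb N c 0 =1 (fun=> 0).
Proof.
elim: n => // n IHn cn0; apply: IHn.
case: n cn0 => [|n] cn0; last first.
  move=> s; rewrite comb_walkS; apply: kernel_op_sqr_eq0 => {}s.
  by rewrite -(cn0 s) [RHS]comb_walkS; apply: eq_kernel_op => r; rewrite comb_walkS.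
(* For the last factor, [comb N c 0] itself must be an image: since [A e_g = e_s0], it equals [A y]
   with [y = q(A) e_g]. *)
pose y s := \sum_(i < N) c i * iter i kernel_op (fun r => (r == g)%:R) s.
have c0E : comb N c 0 =1 kernel_op y.
  move=> s; rewrite [RHS](kernel_op_sum N c (fun i => iter i kernel_op _)).
  apply: eq_bigr => i _; congr (_ * _).
  rewrite add0n -iterS iterSr; elim: (i : nat) s => [|k IHk] s; last exact: eq_kernel_op.
  rewrite /= /kernel_op (bigD1 g) //= eqxx mulr1 big1 ?addr0 ?walk_g //.
  by move=> r /negPf->; rewrite mulr0.
move=> s; rewrite c0E; apply: kernel_op_sqr_eq0 => {}s.
by rewrite -(cn0 s) comb_walkS; apply: eq_kernel_op => r; rewrite c0E.
Qed.

(** The [#|S| + 1] vectors [A^i e_s0] with [i <= #|S|] are linearly dependent, which gives a nonzero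
    [p] with [p(A) e_s0 = 0]. *)
Lemma comb_walk_dep : exists2 q : {poly rat},
  q`_0 != 0 & exists j, comb (size q) (fun i => q`_i) j =1 (fun=> 0).
Proof.
pose d := #|S|; pose M := \matrix_(i < d.+1, j < d) kernel_walk s0 i (enum_val j).
have : kermx M != 0.
  rewrite kermx_eq0 -row_leq_rank -ltnNge ltnS; exact: rank_leq_col.
case/rowV0Pn => u /sub_kermxP uM0 nz_u; pose p := rVpoly u.
have nz_p : p != 0.
  by apply: contraNneq nz_u => p0; rewrite -[u]rVpolyK -/p p0 linear0.
(* Splits off the root 0: [p = q * X^j] with [q] not vanishing at 0. *)
have [j [q]] := multiplicity_XsubC p 0.
rewrite nz_p /= => nrq; rewrite subr0 => pE.
have nz_q : q != 0 by apply: contraNneq nrq => ->; rewrite root0.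
exists q; first by rewrite -horner_coef0.
exists j => s.
have -> : comb (size q) (fun i => q`_i) j s =
    \sum_(0 <= i < d.+1) p`_i * kernel_walk s0 i s.
  have le_p : (size p <= d.+1)%N by apply: size_poly.
  rewrite (big_cat_nat _ le_p) //= [X in _ + X]big_nat_cond.
  rewrite [X in _ + X]big1 ?addr0; last first.
    by move=> i /andP[/andP[le_pi _] _]; rewrite nth_default ?mul0r.
  have szp : size p = (size q + j)%N by rewrite pE size_mulXn // addnC.
  rewrite szp (@big_cat_nat _ _ _ j) ?leq_addl //= big_nat_cond big1 ?add0r.
    rewrite (big_addn 0 _ j) addnK big_mkord.
    by apply: eq_bigr => i _; rewrite pE coefMXn ltnNge leq_addl /= addnK addnC.
  by move=> i /andP[/andP[_ ij] _]; rewrite pE coefMXn ij mul0r.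
rewrite big_mkord; have /rowP/(_ (enum_rank s)) := uM0.
rewrite !mxE => uM; rewrite -[RHS]uM; apply: eq_bigr => i _.
by rewrite mxE enum_rankK coef_rVpoly_ord.
Qed.

Lemma kernel_walk_linear_recurrent (a : nat -> nat) :
  (forall n, (a n)%:R = kernel_walk s0 n s0) -> linear_recurrent a.
Proof.
move=> aE; have [q q0 [j /comb_walk_down cq0]] := comb_walk_dep.
have relq n : \sum_(i < size q) q`_i * (a (n + i)%N)%:R = 0.
  by under eq_bigr do rewrite aE; apply: comb_walk_up.
have nz_q : q != 0 by apply: contraNneq q0 => ->; rewrite coef0.
have lq : lead_coef q != 0 by rewrite lead_coef_eq0.
have a0 : (a 0)%:R = 1 :> rat by rewrite aE /= eqxx.
move: lq relq; rewrite lead_coefE.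
have: (0 < size q)%N by rewrite size_poly_gt0.
case: (size q) => // k _ /= qk relq.
(* The relation is solved for its top term; the last coefficient is nonzero because [q] has nonzero
   constant term. The case [k = 0] would force that constant term to vanish, as [a 0 = 1]. *)
exists k, (fun i => - (q`_(k - i) / q`_k)); split.
- rewrite lt0n; apply: contraNneq q0 => k0; have := relq 0%N.
  by rewrite k0 big_ord1 a0 mulr1 => ->.
- by rewrite subnn oppr_eq0 mulf_neq0 ?invr_eq0.
move=> n le_kn; have := relq (n - k)%N.
rewrite big_ord_recr /= subnK // addrC => /eqP; rewrite addr_eq0 => /eqP qa.
apply: (mulfI qk); rewrite qa mulr_sumr -sumrN big_add1 /=.
rewrite big_nat_rev big_mkord add0n; apply: eq_bigr => i _.
have le_ik := ltnW (ltn_ord i).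
rewrite subnSK // subKn // subnBA // -addnBAC // mulrA mulrN mulNr.
by rewrite mulrCA divff // mulr1.
Qed.

End KernelOperator.

(** * Return counts of symmetric kernels, closed under products and powers *)

Definition symmetric_walk_seq (a : nat -> nat) : Prop :=
  exists (S : finType) (A : S -> S -> rat) (s0 g : S),
    [/\ forall s r, A s r = A r s, forall s, A s g = (s == s0)%:R
      & forall n, (a n)%:R = kernel_walk A s0 n s0].

Lemma symmetric_walk_seq_linear_recurrent a :
  symmetric_walk_seq a -> linear_recurrent a.
Proof.
by case=> S [A [s0 [g [symA Ag aE]]]]; exact: kernel_walk_linear_recurrent Ag _ aE.
Qed.

Lemma symmetric_walk_seq1 : symmetric_walk_seq (fun=> 1%N).
Proof.
exists unit, (fun _ _ => 1), tt, tt; split=> [//|[]//|n].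
have: kernel_walk (fun _ _ : unit => 1) tt n =1 (fun=> 1); last by move=> ->.
elim: n => [|n IHn] [] //=.
by rewrite (eq_kernel_op _ IHn) /kernel_op (bigD1 tt) //= big1 ?addr0 ?mulr1 // => -[].
Qed.

Lemma symmetric_walk_seqM a b :
  symmetric_walk_seq a -> symmetric_walk_seq b ->
  symmetric_walk_seq (fun n => a n * b n)%N.
Proof.
case=> S [A [s0 [g [symA Ag aE]]]] [S' [A' [s0' [g' [symA' Ag' bE]]]]].
(* The tensor product of the two kernels, whose walks factor coordinatewise. *)
pose AA (s r : S * S') := A s.1 r.1 * A' s.2 r.2.
exists (S * S')%type, AA, (s0, s0'), (g, g'); split.
- by move=> s r; rewrite /AA symA symA'.
- by move=> [s s']; rewrite /AA /= Ag Ag' -natrM mulnb xpair_eqE.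
move=> n; rewrite natrM aE bE.
have walkM : kernel_walk AA (s0, s0') n =1
    fun s => kernel_walk A s0 n s.1 * kernel_walk A' s0' n s.2; last by rewrite walkM.
elim: n => [|n IHn] [s s'] /=; first by rewrite -natrM mulnb xpair_eqE.
rewrite (eq_kernel_op _ IHn) /kernel_op big_distrlr pair_bigA /=.
by apply: eq_bigr => -[r r'] _; rewrite /AA /= mulrACA.
Qed.

Lemma symmetric_walk_seqX a t :
  symmetric_walk_seq a -> symmetric_walk_seq (fun n => a n ^ t)%N.
Proof.
move=> wa; elim: t => [|t IHt]; first exact: symmetric_walk_seq1.
have [S [A [s0 [g [symA Ag aE]]]]] := symmetric_walk_seqM wa IHt.
by exists S, A, s0, g; split=> // n; rewrite expnS aE.
Qed.

Local Close Scope ring_scope.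

(** * Neighbours in a path *)

Section Neighbours.
Variable m : nat.
Implicit Types i j : 'I_m.

(* At the ends of 'I_m these return their argument. *)
Definition ord_next i : 'I_m := insubd i i.+1.
Definition ord_prev i : 'I_m := insubd i i.-1.

Definition path_adj i j := (i.+1 == j :> nat) || (j.+1 == i :> nat).

Lemma path_adj_sym : symmetric path_adj.
Proof. by move=> i j; rewrite /path_adj orbC. Qed.

Lemma val_ord_next i : i.+1 < m -> ord_next i = i.+1 :> nat.
Proof. by move=> lt_im; rewrite val_insubd lt_im. Qed.

Lemma val_ord_prev i : ord_prev i = i.-1 :> nat.
Proof. by rewrite val_insubd (leq_ltn_trans (leq_pred i)). Qed.

Lemma ord_next_max i : i.+1 < m = false -> ord_next i = i.
Proof. by move=> ge_im; apply: val_inj; rewrite val_insubd ge_im. Qed.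

Lemma ord_prevK i : 0 < i -> ord_next (ord_prev i) = i.
Proof.
move=> i_gt0; apply: val_inj.
by rewrite /= val_ord_next val_ord_prev prednK.
Qed.

Lemma sum_path_adj i (F : 'I_m -> nat) :
  \sum_(j | path_adj i j) F j =
  (if i.+1 < m then F (ord_next i) else 0) + (if 0 < i then F (ord_prev i) else 0).
Proof.
rewrite (bigID (fun j => i.+1 == j :> nat)) /=; congr (_ + _).
  case: ifPn => [lt_im | ge_im].
    apply: big_pred1 => j; rewrite /path_adj /= -val_eqE /= val_ord_next // [RHS]eq_sym.
    by case: (i.+1 == j :> nat); rewrite ?andbF.
  rewrite big_pred0 // => j; rewrite andbC; case: eqP => // ij.
  by rewrite ij ltn_ord in ge_im.
case: ifPn => [i_gt0 | ].
  apply: big_pred1 => j; rewrite /path_adj /= -val_eqE /= val_ord_prev. lia.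
rewrite -eqn0Ngt => /eqP i0; rewrite big_pred0 // => j.
by rewrite /path_adj i0 orbF andbN.
Qed.

End Neighbours.

(** * Edge labellings as functions of pairs of vertices *)

Section EdgeLabels.
Variables (V : finType) (adj : rel V).
Hypothesis adj_sym : symmetric adj.

Lemma set2_inj (x y z : V) : [set x; y] = [set x; z] -> y = z.
Proof.
move=> E; have: y \in [set x; z] by rewrite -E set22.
rewrite !inE => /orP[/eqP yx|/eqP//]; have: z \in [set x; y] by rewrite E set22.
by rewrite yx !inE orbb => /eqP.
Qed.

Lemma eq_set2 (x y z w : V) : [set x; y] = [set z; w] ->
  (x = z /\ y = w) \/ (x = w /\ y = z).
Proof.
move=> E; have: x \in [set z; w] by rewrite -E set21.
rewrite !inE => /orP[/eqP xz | /eqP xw]; [left | right]; split=> //.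
  by apply: (@set2_inj x); rewrite E xz.
by apply: (@set2_inj x); rewrite E xw setUC.
Qed.

Lemma mem_edges x y : ([set x; y] \in edges adj) = adj x y.
Proof.
rewrite inE; apply/existsP/idP => [[z /existsP[w /andP[zw /eqP]]]|xy].
  by case/eq_set2=> -[-> ->]; rewrite // adj_sym.
by exists x; apply/existsP; exists y; rewrite xy eqxx.
Qed.

(** The default 0 on non-edges makes labels across the border of the grid vanish. *)
Definition label (f : edge adj -> nat) (x y : V) : nat :=
  if insub [set x; y] is Some E then f E else 0.

Lemma labelC f x y : label f x y = label f y x.
Proof. by rewrite /label setUC. Qed.

Lemma label_nadj f x y : ~~ adj x y -> label f x y = 0.
Proof. by move=> nxy; rewrite /label insubF // mem_edges (negPf nxy). Qed.

Lemma label_val f (E : edge adj) x y : val E = [set x; y] -> label f x y = f E.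
Proof. by rewrite /label => <-; rewrite valK. Qed.

Lemma edgeP (E : edge adj) : exists x y, adj x y /\ val E = [set x; y].
Proof.
have /[!inE] /existsP[x /existsP[y /andP[xy /eqP defE]]] := valP E.
by exists x, y.
Qed.

Lemma adj_edge x y : adj x y -> exists E : edge adj, val E = [set x; y].
Proof. by rewrite -mem_edges => xyE; exists (Sub [set x; y] xyE). Qed.

Lemma sum_edges f v :
  \sum_(E : edge adj | v \in val E) f E = \sum_(u | adj v u) label f v u.
Proof.
(* An edge at [v] has exactly one other endpoint [u], so the inner sum has a single term; exchanging
   the sums then indexes by neighbours. *)
transitivity (\sum_(E : edge adj | v \in val E)
    \sum_(u | adj v u && (val E == [set v; u])) f E).
  apply: eq_bigr => E vE.
  have [u [vu defE]] : exists u, adj v u /\ val E = [set v; u].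
    have [x [y [xy defE]]] := edgeP E.
    move: vE; rewrite defE !inE => /orP[]/eqP->; first by exists y.
    by exists x; rewrite adj_sym setUC.
  rewrite (big_pred1 u) // => w /=; rewrite defE.
  by apply/andP/eqP => [[_ /eqP/set2_inj->] | ->].
rewrite (exchange_big_dep (adj v)) => [|E u _ /andP[]//] /=; apply: eq_bigr => u vu.
have [E0 defE0] := adj_edge vu; rewrite (label_val _ defE0).
apply: big_pred1 => E /=; rewrite vu -[RHS]val_eqE defE0 /=.
by case: eqP => [->|]; rewrite ?set21 ?andbF.
Qed.

(* Labelling defined by a function of ordered pairs; the value at an edge is
   independent of the chosen orientation when [G] is symmetric along edges. *)
Definition labelling_of (k : nat) (G : V -> V -> 'I_k.+1) : {ffun edge adj -> 'I_k.+1} :=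
  [ffun E => if [pick p : V * V | val E == [set p.1; p.2]] is Some p
             then G p.1 p.2 else ord0].

Lemma label_labelling_of k (G : V -> V -> 'I_k.+1) x y :
  (forall u v, adj u v -> G u v = G v u) -> adj x y ->
  label (fun E => labelling_of G E) x y = G x y.
Proof.
move=> symG xy; have [E defE] := adj_edge xy; rewrite (label_val _ defE) ffunE defE.
case: pickP => [[z w] /= /eqP | /(_ (x, y))/=]; last by rewrite eqxx.
by case/eq_set2=> -[<- <-] //; rewrite symG // adj_sym.
Qed.

End EdgeLabels.

(** * Vertex sums in the grid *)

Section GridSums.
Variables m n : nat.
Implicit Types (i : 'I_n) (j : 'I_m).

Lemma grid_adjE (x y : 'I_n * 'I_m) : grid_adj x y =
  (x.1 == y.1) && path_adj x.2 y.2 || (x.2 == y.2) && path_adj x.1 y.1.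
Proof.
case: x y => [i j] [i' j']; rewrite /grid_adj /path_adj /= -!val_eqE /=.
move: (i : nat) (j : nat) (i' : nat) (j' : nat) => {}i {}j {}i' {}j'.
by lia.
Qed.

Lemma grid_adj_sym : symmetric (@grid_adj m n).
Proof.
move=> x y; rewrite !grid_adjE (eq_sym y.1) (eq_sym y.2).
by rewrite (path_adj_sym y.1) (path_adj_sym y.2).
Qed.

Lemma sum_grid_adj i j (F : 'I_n * 'I_m -> nat) :
  \sum_(u | grid_adj (i, j) u) F u =
  \sum_(i' | path_adj i i') F (i', j) + \sum_(j' | path_adj j j') F (i, j').
Proof.
have irr k (a : 'I_k) : path_adj a a = false by rewrite /path_adj; lia.
rewrite (bigID (fun u => u.2 == j)) /=; congr (_ + _).
  rewrite (reindex_onto (fun i' => (i', j)) fst) /=; last first.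
    by move=> [i' j'] /= /andP[_ /eqP->].
  by apply: eq_bigl => i'; rewrite grid_adjE /= !eqxx irr andbF !andbT.
rewrite (reindex_onto (fun j' => (i, j')) snd) /=; last first.
  move=> [i' j'] /=; rewrite grid_adjE /= (eq_sym j).
  by case: (j' == j); rewrite ?andbF // andbT orbF => /andP[/eqP->].
apply: eq_bigl => j'; rewrite grid_adjE /= !eqxx irr andbF orbF !andbT /=.
by case: eqP => [->|]; rewrite ?irr ?andbT.
Qed.

Variable f : edge (@grid_adj m n) -> nat.

(** Each edge is indexed by its endpoint with smaller coordinates. In the last column
    [ord_next i = i], so the pair is no edge and the value is 0. *)
Definition hlabel i j := label f (i, j) (ord_next i, j).
Definition vlabel i j := label f (i, j) (i, ord_next j).

Lemma hlabel_max i j : i.+1 < n = false -> hlabel i j = 0.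
Proof.
move=> /ord_next_max ni; apply: (label_nadj grid_adj_sym).
by rewrite ni grid_adjE /path_adj /=; lia.
Qed.

Lemma vlabel_max i j : j.+1 < m = false -> vlabel i j = 0.
Proof.
move=> /ord_next_max nj; apply: (label_nadj grid_adj_sym).
by rewrite nj grid_adjE /path_adj /=; lia.
Qed.

Lemma grid_sum_edges i j :
  \sum_(E : edge (@grid_adj m n) | (i, j) \in val E) f E =
  (hlabel i j + (if 0 < i then hlabel (ord_prev i) j else 0)) +
  (vlabel i j + (if 0 < j then vlabel i (ord_prev j) else 0)).
Proof.
rewrite (sum_edges grid_adj_sym) sum_grid_adj !sum_path_adj.
congr (_ + _ + (_ + _)).
- by case: ifP => // /hlabel_max->.
- by case: ifP => // i_gt0; rewrite /hlabel ord_prevK // labelC.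
- by case: ifP => // /vlabel_max->.
by case: ifP => // j_gt0; rewrite /vlabel ord_prevK // labelC.
Qed.

End GridSums.

(** * The transfer matrix and its walks as chains of columns *)

Section Transfer.
Variables m t : nat.

(* The labels of a column of vertical edges, or of the horizontal edges between
   two consecutive columns; the vertical edge leaving the last vertex of a
   column does not exist and gets label 0. *)
Definition column_state : finType := {ffun 'I_m -> 'I_t.+1}.
Implicit Types s r v : column_state.

Definition state0 : column_state := [ffun=> ord0].
Definition state_max : column_state := [ffun=> ord_max].

Definition column_ok s r v : bool :=
  [forall j, (s j + r j + (v j + (if 0 < j then v (ord_prev j) : nat else 0)) == t)
             && ((j.+1 < m) || (v j == 0 :> nat))].

Definition transfer s r : rat := (#|[set v | column_ok s r v]|%:R)%R.

Lemma transfer_sym s r : transfer s r = transfer r s.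
Proof.
congr (_%:R)%R; apply: eq_card => v; rewrite !inE.
by apply: eq_forallb => j; rewrite [s j + r j]addnC.
Qed.

(** Labels [t] on the right already saturate every vertex, so [s] and the vertical labels must be
    0. *)
Lemma transfer_max s : transfer s state_max = ((s == state0)%:R)%R.
Proof.
have okP v : column_ok s state_max v -> s = state0 /\ v = state0.
  by move=> /forallP ok; split; apply/ffunP => j; apply: val_inj;
    have /andP[/eqP + _] := ok j; rewrite !ffunE /=; lia.
congr (_%:R)%R; case: eqP => [s0 | nz_s]; last first.
  by apply: eq_card0 => v; rewrite inE; apply/negP => /okP[].
apply: (@eq_card1 _ state0) => v; rewrite !inE; apply/idP/eqP => [/okP[]//|->].
by apply/forallP => j; rewrite s0 !ffunE /= if_same add0n !addn0 !eqxx orbT.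
Qed.

(** Each pair holds the labels to the right of a column and its vertical labels; [s] is the state on
    the left. *)
Fixpoint chain s (x : seq (column_state * column_state)) : bool :=
  if x is p :: x' then column_ok s p.1 p.2 && chain p.1 x' else s == state0.

(** Peel off the first pair [(r, v)]: the choices of [v] number [transfer s r], and the tail is a
    chain from [r]. *)
Lemma card_chain n s :
  (#|[set x : n.-tuple (column_state * column_state) | chain s x]|%:R =
   kernel_walk transfer state0 n s :> rat)%R.
Proof.
elim: n s => [|n IHn] s.
  congr (_%:R)%R.
  transitivity #|[set x : 0.-tuple (column_state * column_state) | s == state0]|.
    by apply: eq_card => x; rewrite !inE tuple0.
  by case: eqP => _; rewrite ?cards0 // cardsT card_tuple expn0.
rewrite /kernel_walk /= -/(kernel_walk _ _ _).
rewrite -sum1dep_card (reindex (fun p : (column_state * column_state) * n.-tuple _ =>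
  cons_tuple p.1 p.2)) /=; last first.
  exists (fun x : n.+1.-tuple _ => (thead x, behead_tuple x)) => [[p x] _|x _] /=.
    by congr pair; apply: val_inj.
  by rewrite [RHS]tuple_eta.
rewrite -(pair_big_dep (fun p => column_ok s p.1 p.2) (fun p (x : n.-tuple _) => chain p.1 x)
  (fun _ _ => 1)) /=.
rewrite -(pair_big_dep xpredT (fun r v => column_ok s r v)
  (fun r v => \sum_(x : n.-tuple _ | chain r x) 1)) /=.
rewrite natr_sum /kernel_op; apply: eq_bigr => r _.
by rewrite sum_nat_const sum1dep_card natrM IHn /transfer cardsE.
Qed.

Lemma chainP d s x : reflect
  (last s (map fst x) = state0 /\ forall i, i < size x ->
     column_ok (nth d (s :: map fst x) i) (nth d (map fst x) i) (nth d (map snd x) i))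
  (chain s x).
Proof.
elim: x s => [|p x IHx] s /=.
  by apply: (iffP eqP) => [|[]].
apply: (iffP andP) => [[ok /IHx[last0 okx]] | [last0 ok]].
  by split=> // -[|i] //=; apply: okx.
split; first exact: (ok 0).
by apply/IHx; split=> // i ix; apply: (ok i.+1).
Qed.

(** Makes the recursive condition local to each column, ready to be compared with the conditions at
    vertices. *)
Lemma chain_tuple n (x : n.-tuple (column_state * column_state)) :
  chain state0 x =
  [forall i : 'I_n, column_ok (if 0 < i then (tnth x (ord_prev i)).1 else state0)
                       (tnth x i).1 (tnth x i).2
             && ((i.+1 < n) || ((tnth x i).1 == state0))].
Proof.
have nth1 (i : 'I_n) : nth state0 (map fst x) i = (tnth x i).1.
  by rewrite (nth_map (state0, state0)) ?size_tuple // -tnth_nth.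
have nth2 (i : 'I_n) : nth state0 (map snd x) i = (tnth x i).2.
  by rewrite (nth_map (state0, state0)) ?size_tuple // -tnth_nth.
have nth0 (i : 'I_n) : nth state0 (state0 :: map fst x) i =
    if 0 < i then (tnth x (ord_prev i)).1 else state0.
  by rewrite -nth1 val_ord_prev; case: (nat_of_ord i).
apply/(chainP state0)/forallP => [[last0 ok] i | ok].
  rewrite -nth0 -nth1 -nth2 ok ?size_tuple //=.
  case: ltnP => //= ge_ni; move: last0.
  rewrite (last_nth state0) size_map size_tuple.
  have nE : i.+1 = n by apply/eqP; rewrite eqn_leq ge_ni ltn_ord.
  by have /= <- := congr1 (nth state0 (state0 :: map fst x)) nE => ->.
split; last first.
  rewrite size_tuple => i lt_in; have /andP[] := ok (Ordinal lt_in).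
  by rewrite -nth0 -nth1 -nth2.
rewrite (last_nth state0) size_map size_tuple.
case: n x nth1 {nth2 nth0} ok => // k x nth1 ok.
have /andP[_] := ok ord_max; rewrite ltnn -nth1 => /eqP; exact.
Qed.

End Transfer.

(** * Bijection between magic labellings and chains *)

Section GridColumns.
Variables m n t : nat.
Local Notation E := (edge (@grid_adj m n)).
Local Notation natf f := (fun e => nat_of_ord (f e)).
Local Notation state := (column_state m t).

Definition columns (f : {ffun E -> 'I_t.+1}) : n.-tuple (state * state) :=
  [tuple ([ffun j => inord (hlabel (natf f) i j)],
          [ffun j => inord (vlabel (natf f) i j)]) | i < n].

Lemma label_le (f : {ffun E -> 'I_t.+1}) x y : label (natf f) x y < t.+1.
Proof. by rewrite /label; case: insub. Qed.

Lemma columns_h f i j : (tnth (columns f) i).1 j = hlabel (natf f) i j :> nat.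
Proof. by rewrite tnth_mktuple ffunE inordK ?label_le. Qed.

Lemma columns_v f i j : (tnth (columns f) i).2 j = vlabel (natf f) i j :> nat.
Proof. by rewrite tnth_mktuple ffunE inordK ?label_le. Qed.

Lemma chain_columns (f : {ffun E -> 'I_t.+1}) :
  chain (state0 m t) (columns f) = magic_labelling t (natf f).
Proof.
rewrite chain_tuple; set x := columns f.
(* The left side of the [column_ok] equation is the vertex sum at [(i, j)]; the remaining clauses of
   [chain] concern absent edges, labelled 0. *)
have colE (i : 'I_n) j :
    (if 0 < i then (tnth x (ord_prev i)).1 else state0 m t) j + (tnth x i).1 j +
    ((tnth x i).2 j + (if 0 < j then (tnth x i).2 (ord_prev j) : nat else 0)) =
    \sum_(e : E | (i, j) \in val e) f e.
  rewrite (@grid_sum_edges m n (natf f)) columns_h columns_v [X in X + _ = _]addnC.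
  congr (_ + _ + (_ + _)).
    by case: ifP; rewrite ?columns_h ?ffunE.
  by case: ifP; rewrite ?columns_v.
apply/forallP/forallP => [ok [i j] | mag i].
  by have /andP[/forallP/(_ j)/andP[+ _] _] := ok i; rewrite colE.
apply/andP; split.
  apply/forallP => j; rewrite colE; have -> /= := mag (i, j).
  by case: ltnP => //= ge_jm; rewrite columns_v vlabel_max // ltnNge ge_jm.
case: ltnP => //= ge_in; apply/eqP/ffunP => j; apply: val_inj.
by rewrite /= columns_h ffunE hlabel_max // ltnNge ge_in.
Qed.

(** Up to orientation, every edge joins a vertex to its [ord_next] in one coordinate, so its label
    is recorded in [columns]. *)
Lemma columns_inj : injective columns.
Proof.
move=> f f' eqff'; apply/ffunP => e; apply: val_inj => /=.
have eqh i j : hlabel (natf f) i j = hlabel (natf f') i j by rewrite -!columns_h eqff'.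
have eqv i j : vlabel (natf f) i j = vlabel (natf f') i j by rewrite -!columns_v eqff'.
have [x [y [xy defe]]] := edgeP e.
rewrite -(label_val (natf f) defe) -(label_val (natf f') defe); move: xy {e defe}.
have next k (a b : 'I_k) : a.+1 = b -> b = ord_next a.
  by move=> ab; apply: val_inj; rewrite /= val_ord_next ab.
case: x y => [i j] [i' j']; rewrite grid_adjE => /orP[] /andP[/eqP/= <-] /orP[] /eqP/next->.
- exact: eqv.
- by rewrite ![label _ _ (i, j')]labelC; apply: eqv.
- exact: eqh.
by rewrite ![label _ _ (i', j)]labelC; apply: eqh.
Qed.

(** Inverse of [columns]: the label is read at the smaller endpoint, which makes it symmetric on
    adjacent pairs. *)
Definition pair_label (x : n.-tuple (state * state)) (a b : 'I_n * 'I_m) : 'I_t.+1 :=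
  if a.1 == b.1 then (tnth x a.1).2 (if a.2 < b.2 then a.2 else b.2)
  else (tnth x (if a.1 < b.1 then a.1 else b.1)).1 a.2.

Lemma pair_labelC x a b : grid_adj a b -> pair_label x a b = pair_label x b a.
Proof.
case: a b => [i j] [i' j'].
rewrite grid_adjE /pair_label /= (eq_sym i') => /orP[]/andP[/eqP<-]; rewrite ?eqxx.
  by case: (ltngtP j j') => // /ord_inj->.
by case: eqP => [->//|_]; case: (ltngtP i i') => // /ord_inj->.
Qed.

Lemma columns_surj (x : n.-tuple (state * state)) : chain (state0 m t) x ->
  exists f, columns f = x.
Proof.
rewrite chain_tuple => /forallP ok; pose f := labelling_of (@grid_adj m n) (pair_label x).
have fE := label_labelling_of (@grid_adj_sym m n) (@pair_labelC x).
exists f; apply: eq_from_tnth => i; rewrite [RHS]surjective_pairing [LHS]surjective_pairing.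
have /andP[/forallP oki hi] := ok i.
congr pair; apply/ffunP => j; apply: val_inj; rewrite /= ?columns_h ?columns_v.
  (* In the last column, and below in the last row, no edge leaves the vertex; there the chain
     conditions force the entry of [x] to be 0, like the label. *)
  case: ltnP hi => /= [lt_in _ | ge_in /eqP->]; last first.
    by rewrite hlabel_max ?ffunE // ltnNge ge_in.
  rewrite /hlabel fE.
    by rewrite /pair_label /= -val_eqE /= val_ord_next // ltn_eqF ?ltnSn.
  by rewrite grid_adjE /= eqxx /path_adj val_ord_next // eqxx orbT.
have /andP[_] := oki j; case: ltnP => /= [lt_jm _ | ge_jm /eqP->]; last first.
  by rewrite vlabel_max // ltnNge ge_jm.
rewrite /vlabel fE.
  by rewrite /pair_label /= eqxx val_ord_next // ltnSn.
by rewrite grid_adjE /= eqxx /path_adj val_ord_next // eqxx.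
Qed.

Lemma T_card_chain :
  T m n t = #|[set x : n.-tuple (state * state) | chain (state0 m t) x]|.
Proof.
rewrite /T /magic_count -(card_imset _ columns_inj).
apply: eq_card => x; rewrite inE; apply/imsetP/idP => [[f]|cx].
  by rewrite inE -chain_columns => ? ->.
have [f fx] := columns_surj cx.
by exists f; rewrite // inE -chain_columns fx.
Qed.

End GridColumns.

Lemma T_symmetric_walk_seq m t : symmetric_walk_seq (fun n => T m n t).
Proof.
exists (column_state m t), (@transfer m t), (state0 m t), (state_max m t).
split; [exact: transfer_sym | exact: transfer_max |].
by move=> n; rewrite T_card_chain card_chain.
Qed.

Theorem theorem1p6 (m t : nat) (hm : 0 < m) (ht : 0 < t) :
  linear_recurrent (fun n : nat => T m n t) /\
  linear_recurrent (fun n : nat => T m n 1 ^ t).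
Proof.
split; apply: symmetric_walk_seq_linear_recurrent.
  exact: T_symmetric_walk_seq.
exact/symmetric_walk_seqX/T_symmetric_walk_seq.
Qed.
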